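(* Let $n\ge 0$ be an integer and let $\lambda,\mu\in\mathcal B(n)$. Then $\mathrm{pre}_2(\lambda)=\mathrm{pre}_2(\mu)$ if and only if $\lambda=\mu$.
   Context: A partition $\lambda=(\lambda_1,\dots,\lambda_\ell)$ of $n$ is a weakly decreasing sequence of positive integers with sum $n$, identified with its multiset of parts; $\ell(\lambda)=\ell$ is its length. A binary partition is a partition all of whose parts are powers of $2$ (including $2^0=1$), and $\mathcal B(n)$ is the set of binary partitions of $n$. For a partition $\lambda$ with $\ell(\lambda)\ge2$, $\mathrm{pre}_2(\lambda)$ is the partition whose multiset of parts is $\{\lambda_i\lambda_k\mid 1\le i<k\le\ell(\lambda)\}$ (with multiplicity, one part for each pair $i<k$); if $\ell(\lambda)<2$, $\mathrm{pre}_2(\lambda)=\emptyset$. *)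

(* Defs.v *)
From mathcomp Require Import all_boot.

Set Implicit Arguments.
Unset Strict Implicit.
Unset Printing Implicit Defensive.

(* A partition is represented by its weakly decreasing sequence of positive   *)
(* parts, so Leibniz equality of sequences is equality of partitions.         *)
Definition is_partition (la : seq nat) : bool := sorted geq la && (0 \notin la).

Definition partition_of (n : nat) (la : seq nat) : Prop :=
  is_partition la /\ sumn la = n.

Definition binary_partition (n : nat) (la : seq nat) : Prop :=
  partition_of n la /\ (forall p : nat, p \in la -> exists k : nat, p = 2 ^ k).

(* One product for each pair of positions i < k, counted from 0; there is no  *)
(* such pair when size la < 2 (see pre2_small).                               *)
Definition pair_products (la : seq nat) : seq nat :=
  [seq nth 0 la i * nth 0 la k
     | i <- iota 0 (size la), k <- index_iota i.+1 (size la)].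

Definition pre2 (la : seq nat) : seq nat := sort geq (pair_products la).

Lemma pre2_small (la : seq nat) : size la < 2 -> pre2 la = [::].
Proof. by case: la => [|x [|y la]]. Qed.

Lemma perm_pre2 (la : seq nat) : perm_eq (pre2 la) (pair_products la).
Proof. exact/permPl/perm_sort. Qed.

Lemma pre2_is_partition (la : seq nat) :
  is_partition la -> is_partition (pre2 la).
Proof.
case/andP=> _ la0; apply/andP; split.
  by apply: sort_sorted => x y; apply: leq_total.
rewrite mem_sort; apply/negP => /allpairsPdep [i [k [Hi Hk]]].
move: Hi Hk; rewrite mem_iota mem_index_iota add0n => /= Hi /andP[_ Hk] /eqP.
by rewrite eq_sym muln_eq0 => /orP[] /eqP E;
  case/negP: la0; rewrite -E mem_nth.
Qed.

(* Main.v *)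
Require Import Defs.
From mathcomp Require Import all_boot.
From mathcomp Require Import zify.

(** Let P_k be the k-th power sum of the parts. Since
      P_k(la)^2 = P_2k(la) + 2 * (sum of the k-th powers of the parts of pre2 la),
    the partition pre2 la and P_k(la) determine P_2k(la). As P_1(la) = n is
    given, all the power sums of exponent 2^m are determined by pre2 la. These
    determine la: after cancelling equal leading parts, the partition with the
    larger leading part has the larger power sum for large exponents. *)

Definition power_sum (k : nat) (s : seq nat) : nat := \sum_(x <- s) x ^ k.

(** The pairs with first index 0 give the block of multiples of [x]; all other pairs are pairs of
    [s] with both indices shifted by one. *)
Lemma pair_products_cons (x : nat) (s : seq nat) :
  pair_products (x :: s) = map (muln x) s ++ pair_products s.
Proof.
rewrite /pair_products /= (iotaDl 1 0) -map_comp; congr (_ ++ flatten _).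
  rewrite /index_iota subn1 /= (iotaDl 1 0) -map_comp.
  by rewrite -[in RHS](mkseq_nth 0 s) /mkseq -map_comp; apply: eq_map.
apply: eq_map => i /=.
rewrite /index_iota add1n subSS -(add1n i.+1) iotaDl -map_comp.
exact: eq_map.
Qed.

Lemma power_sum_sqr (k : nat) (s : seq nat) :
  power_sum k s ^ 2 = power_sum (k * 2) s + 2 * power_sum k (pair_products s).
Proof.
rewrite /power_sum; elim: s => [|x s IHs]; first by rewrite !big_nil.
rewrite pair_products_cons big_cat /= big_map !big_cons sqrnD {}IHs expnM.
under [\sum_(y <- s) (x * y) ^ k]eq_bigr => y _ do rewrite expnMn.
rewrite -big_distrr /=; lia.
Qed.

Lemma power_sum_pow2_eq (s t : seq nat) (m : nat) :
  sumn s = sumn t -> perm_eq (pair_products s) (pair_products t) ->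
  power_sum (2 ^ m) s = power_sum (2 ^ m) t.
Proof.
move=> sum_st pair_st; elim: m => [|m IHm]; first by move: sum_st; rewrite !sumnE.
have := power_sum_sqr (2 ^ m) t; rewrite -IHm power_sum_sqr expnSr.
have -> : power_sum (2 ^ m) (pair_products s) = power_sum (2 ^ m) (pair_products t).
  exact: perm_big.
exact: addIn.
Qed.

(** Bernoulli's inequality [(1 + 1/x)^k >= 1 + k/x], multiplied by [x^(k+1)] to avoid division. *)
Lemma bernoulli_expn (x k : nat) : x ^ k * (x + k) <= x * x.+1 ^ k.
Proof.
elim: k => [|k IHk]; first by rewrite !expn0; lia.
rewrite !expnSr mulnA; apply: leq_trans (leq_mul IHk (leqnn x.+1)).
by rewrite -!mulnA leq_mul2l; apply/orP; right; lia.
Qed.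

Lemma power_sum_lt_expn (s : seq nat) (y : nat) :
  {in s, forall x, x < y} -> 0 < y -> exists m, power_sum (2 ^ m) s < y ^ (2 ^ m).
Proof.
(* From here [y] is the old bound minus one, so [power_sum k s] is at most [size s * y ^ k]. By
   Bernoulli, [y.+1 ^ k] exceeds this once [k > size s * y], which holds because [2 ^ m > m]. *)
case: y => // y s_le_y _; exists (size s * y); set k := 2 ^ _.
have k_gt : size s * y < k by apply: ltn_expl.
have sum_le : power_sum k s <= size s * y ^ k.
  rewrite /power_sum -sum1_size big_distrl /= !big_seq.
  by apply: leq_sum => x /s_le_y; rewrite mul1n ltnS => x_le; rewrite leq_exp2r ?expn_gt0.
apply: leq_ltn_trans sum_le _.
have [->|y_gt0] := posnP y; first by rewrite exp0n ?muln0 ?expn_gt0 //; lia.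
rewrite -(ltn_pmul2l y_gt0); apply: leq_trans (bernoulli_expn y k).
by rewrite mulnA mulnC ltn_pmul2l ?expn_gt0 ?y_gt0 //; lia.
Qed.

Lemma power_sum_pow2_inj (s t : seq nat) :
  is_partition s -> is_partition t ->
  (forall m, power_sum (2 ^ m) s = power_sum (2 ^ m) t) -> s = t.
Proof.
(* Used in both directions, this equates the leading parts. The default 0 of [head] lets it also
   cover an empty [u], where its conclusion contradicts [0 < y]; this rules out lists of which only
   one is empty. *)
have head_le y u v : is_partition u -> 0 < y ->
    (forall m, power_sum (2 ^ m) u = power_sum (2 ^ m) (y :: v)) -> y <= head 0 u.
  case/andP=> u_sorted _ y_gt0 eq_uv; rewrite leqNgt; apply/negP => head_lt.
  have u_lt : {in u, forall x, x < y}.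
    case: u u_sorted head_lt {eq_uv} => //= z u.
    rewrite (path_sortedE (rev_trans leq_trans)) => /andP[/allP z_max _] z_lt x.
    by rewrite inE => /predU1P[-> //|/z_max /leq_ltn_trans]; apply.
  have [m] := power_sum_lt_expn u y u_lt y_gt0.
  by rewrite eq_uv /power_sum big_cons ltnNge leq_addr.
have head_gt0 x u : is_partition (x :: u) -> 0 < x.
  by rewrite /is_partition inE negb_or lt0n eq_sym => /and3P[].
have behead_part x u : is_partition (x :: u) -> is_partition u.
  rewrite /is_partition inE negb_or => /and3P[/path_sorted u_sorted _ ->].
  by rewrite u_sorted.
elim: s t => [|x s IHs] [|y t] part_s part_t eq_st //.
- have := head_le y _ t part_s (head_gt0 _ _ part_t) eq_st.
  by rewrite leqNgt (head_gt0 _ _ part_t).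
- have := head_le x _ s part_t (head_gt0 _ _ part_s) (fun m => esym (eq_st m)).
  by rewrite leqNgt (head_gt0 _ _ part_s).
have eq_xy : x = y.
  apply/eqP; rewrite eqn_leq.
  by rewrite (head_le x _ s part_t (head_gt0 _ _ part_s) (fun m => esym (eq_st m)))
             (head_le y _ t part_s (head_gt0 _ _ part_t) eq_st).
rewrite -eq_xy in part_t eq_st *; congr (_ :: _); apply: IHs.
- exact: behead_part part_s.
- exact: behead_part part_t.
by move=> m; have := eq_st m; rewrite /power_sum !big_cons => /addnI.
Qed.

Theorem proposition2 (n : nat) (la mu : seq nat)
    (hla : binary_partition n la) (hmu : binary_partition n mu) :
  pre2 la = pre2 mu <-> la = mu.
Proof.
split=> [pre_eq|->] //.
have [[part_la sum_la] _] := hla; have [[part_mu sum_mu] _] := hmu.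
apply: power_sum_pow2_inj => // m; apply: power_sum_pow2_eq.
  by rewrite sum_la sum_mu.
by rewrite -(permPl (perm_pre2 la)) pre_eq perm_pre2.
Qed.
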